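(* Let $S=\mathbb{K}[x_1,\dots,x_n]$ be a polynomial ring over a field $\mathbb{K}$. Every weakly polymatroidal monomial ideal $I\subset S$ is variable decomposable.
   Context: $G(I)$ denotes the set of minimal monomial generators of a monomial ideal $I$, and $\mathfrak{m}=\langle x_1,\dots,x_n\rangle$. For distinct monomials $u=x^{\mathbf a}$, $v=x^{\mathbf b}$ write $u\succ_{lex}v$ if there is an index $t$ with $\mathbf a(i)=\mathbf b(i)$ for $1\le i<t$ and $\mathbf a(t)>\mathbf b(t)$. A monomial ideal $I$ is weakly polymatroidal if for every two monomials $u\succ_{lex}v$ in $G(I)$: if $t$ is the smallest index with $\deg_{x_t}(u)>\deg_{x_t}(v)$, then there exists $j>t$ (with $x_j$ dividing $v$) such that $x_t(v/x_j)\in I$. Principal monomial ideals are trivially weakly polymatroidal. Variable decomposable monomial ideals are defined recursively on the number of variables: a monomial ideal $I\subset S=\mathbb{K}[x_1,\dots,x_n]$ is variable decomposable if either (a) $I=\langle 0\rangle$ or $I=\langle 1\rangle$, or (b) there is a variable $x_v$ (called a shedding variable) such that, with $r=\max\{\deg_{x_v}(u):u\in G(I)\}$, all the ideals $$I_i:=\langle u/x_v^i: u\in G(I)\text{ and }\deg_{x_v}(u)=i\rangle\subset\mathbb{K}[x_1,\dots,\widehat{x_v},\dots,x_n],\qquad i=0,1,\dots,r,$$ are variable decomposable, and $I_{i-1}\subset I_i\mathfrak{m}$ for each $i=1,2,\dots,r$ (here the $I_i$ are extended to ideals of $S$). *)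

(* Defs.v *)
From mathcomp Require Import all_boot all_order all_algebra.
From mathcomp Require Export mpoly.
From Stdlib Require Import Classical.

Set Implicit Arguments.
Unset Strict Implicit.
Unset Printing Implicit Defensive.

Import GRing.Theory.
Local Open Scope ring_scope.

Section Ideals.
Variable R : comNzRingType.
Implicit Types I J : R -> Prop.

Definition is_ideal I : Prop :=
  [/\ I 0,
      forall p q, I p -> I q -> I (p + q)
    & forall p q, I q -> I (p * q)].

Definition ideal_gen (A : R -> Prop) : R -> Prop :=
  fun p => forall J, is_ideal J -> (forall a, A a -> J a) -> J p.

Definition ideal_mul I J : R -> Prop :=
  ideal_gen (fun p => exists a b, [/\ I a, J b & p = a * b]).

Definition ideal_sub I J : Prop := forall p, I p -> J p.

Definition ideal_eq I J : Prop := forall p, I p <-> J p.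

Definition ideal0 : R -> Prop := ideal_gen (fun p => p = 0).

Definition ideal1 : R -> Prop := ideal_gen (fun p => p = 1).

End Ideals.

(* Exponent vectors stand for monomials: a monomial x^m is m : 'X_{1..n}, and
   x_1, ..., x_n are indexed by 'I_n. *)
Section MonomialIdeals.
Variables (K : fieldType) (n : nat).
Implicit Types (I : {mpoly K[n]} -> Prop) (M : 'X_{1..n} -> Prop).

Definition mon_ideal M : {mpoly K[n]} -> Prop :=
  ideal_gen (fun p => exists2 m, M m & p = 'X_[m]).

Definition monomial_ideal I : Prop := exists M, ideal_eq I (mon_ideal M).

Definition max_ideal : {mpoly K[n]} -> Prop :=
  ideal_gen (fun p => exists i : 'I_n, p = 'X_i).

(* G(I), as the monomials of I that are minimal for divisibility ((_ <= _)%MM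
   is componentwise); see mingens_gen and mingens_min below. *)
Definition mingens I : 'X_{1..n} -> Prop := fun u =>
  I 'X_[u] /\ forall w, I 'X_[w] -> (w <= u)%MM -> w = u.

Definition lex_gt (u v : 'X_{1..n}) : Prop :=
  exists t : 'I_n, (forall i : 'I_n, (i < t)%N -> u i = v i) /\ (v t < u t)%N.

(* As x_j divides x^v, the exponent of the monomial x^v / x_j is v - U_(j). *)
Definition weakly_polymatroidal I : Prop :=
  forall u v, mingens I u -> mingens I v -> lex_gt u v ->
  forall t : 'I_n, (v t < u t)%N ->
    (forall i : 'I_n, (i < t)%N -> (u i <= v i)%N) ->
  exists j : 'I_n,
    [/\ (t < j)%N, (0 < v j)%N & I ('X_t * 'X_[(v - U_(j))%MM])].

Lemma ideal_gen_ideal (A : {mpoly K[n]} -> Prop) : is_ideal (ideal_gen A).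
Proof.
split=> [J [J0 _ _] _ //|p q Ip Iq J HJ AJ|p q Iq J HJ AJ].
  by case: (HJ) => _ JD _; apply: JD; [exact: Ip | exact: Iq].
by case: (HJ) => _ _; apply; exact: Iq.
Qed.

Lemma mon_ideal_msupp M p : mon_ideal M p ->
  forall m, m \in msupp p -> exists2 a, M a & (a <= m)%MM.
Proof.
move=> /(_ (fun p => forall m, m \in msupp p -> exists2 a, M a & (a <= m)%MM)).
apply.
- split=> [m|q1 q2 H1 H2 m|q1 q2 H2 m]; first by rewrite msupp0.
    by move/msuppD_le; rewrite mem_cat => /orP[/H1|/H2].
  move/msuppM_le/allpairsP=> [[m1 m2] /= [_ /H2 [a Ma le_a] ->]].
  by exists a => //; exact: lepm_trans le_a (lem_addl _ _).
- move=> _ [a Ma ->] m; rewrite msuppX inE => /eqP ->.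
  by exists a => //; exact: lepm_refl.
Qed.

Lemma mingens_below I m : I 'X_[m] -> exists2 u, mingens I u & (u <= m)%MM.
Proof.
have [k] := ubnP (mdeg m); elim: k m => // k IH m lt_mk Im.
have [[w [Iw le_wm ne_wm]]|Hmin] :=
    classic (exists w, [/\ I 'X_[w], (w <= m)%MM & w <> m]).
  have lt_w : (mdeg w < mdeg m)%N.
    rewrite -(submK le_wm) mdegD -[X in (X < _)%N]add0n ltn_add2r lt0n mdeg_eq0.
    by apply/eqP=> e; apply: ne_wm; rewrite -(submK le_wm) e add0m.
  have [u Gu le_uw] := IH w (leq_trans lt_w lt_mk) Iw.
  by exists u => //; exact: lepm_trans le_uw le_wm.
exists m; last exact: lepm_refl.
by split=> // w Iw le_wm; apply: NNPP => ne; apply: Hmin; exists w.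
Qed.

Lemma mingens_gen I : monomial_ideal I -> ideal_eq I (mon_ideal (mingens I)).
Proof.
move=> [M IM] p; split=> [/IM Ip|Gp].
  apply: Ip; first exact: ideal_gen_ideal.
  move=> _ [m Mm ->].
  have /mingens_below [u Gu le_um]: I 'X_[m] by apply/IM => J _; apply; exists m.
  move=> J HJ GJ; rewrite -(submK le_um) mpolyXD.
  by case: (HJ) => _ _; apply; apply: GJ; exists u.
apply/IM; apply: Gp; first exact: ideal_gen_ideal.
by move=> _ [u [Iu _] ->]; apply/IM.
Qed.

Lemma mingens_min I M :
  ideal_eq I (mon_ideal M) -> forall u, mingens I u -> M u.
Proof.
move=> IM u [/IM Iu umin].
have [|a Ma le_au] := mon_ideal_msupp Iu (m := u); first by rewrite msuppX inE.
by rewrite -(umin a) //; apply/IM => J _; apply; exists a.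
Qed.

End MonomialIdeals.

Section Shedding.
Variables (K : fieldType) (n : nat) (v : 'I_n.+1).

(* The variables of K[x_1, ..., ^x_v, ..., x_(n+1)] are indexed by 'I_n through
   the increasing bijection lift v : 'I_n -> 'I_n.+1 \ {v}. *)
Definition ext_ideal (J : {mpoly K[n]} -> Prop) : {mpoly K[n.+1]} -> Prop :=
  ideal_gen (fun p => exists2 q, J q &
    p = q \mPo [tuple 'X_(lift v i) | i < n]).

(* For a monomial u of degree i in x_v, u / x_v^i is u with its v-th exponent
   forgotten. *)
Definition mnm_drop (u : 'X_{1..n.+1}) : 'X_{1..n} :=
  [multinom u (lift v i) | i < n].

Definition slice (I : {mpoly K[n.+1]} -> Prop) (i : nat) : {mpoly K[n]} -> Prop :=
  mon_ideal (fun m => exists u, [/\ mingens I u, u v = i & m = mnm_drop u]).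

End Shedding.

Definition is_max_degree (K : fieldType) (n : nat) (v : 'I_n)
    (I : {mpoly K[n]} -> Prop) (r : nat) : Prop :=
  (exists2 u, mingens I u & u v = r) /\ (forall u, mingens I u -> (u v <= r)%N).

Fixpoint variable_decomposable (K : fieldType) (n : nat) :
    ({mpoly K[n]} -> Prop) -> Prop :=
  match n return ({mpoly K[n]} -> Prop) -> Prop with
  | 0 => fun I => ideal_eq I (@ideal0 _) \/ ideal_eq I (@ideal1 _)
  | n'.+1 => fun I =>
    [\/ ideal_eq I (@ideal0 _),
        ideal_eq I (@ideal1 _)
      | exists (v : 'I_n'.+1) (r : nat),
        [/\ is_max_degree v I r,
            forall i, (i <= r)%N -> variable_decomposable (slice v I i)
          & forall i, (1 <= i <= r)%N ->
              ideal_sub (ext_ideal v (slice v I i.-1))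
                (ideal_mul (ext_ideal v (slice v I i)) (@max_ideal K n'.+1))]]
  end.

(* Main.v *)
Require Import Defs.
From mathcomp Require Import all_boot all_order all_algebra.
From mathcomp Require Import zify.
From Stdlib Require Import Classical.

(** Slice [I] along its first variable [x_0].  If [w] is a minimal generator
    and some minimal generator has a larger exponent of [x_0], the exchange
    property at [t = 0] puts [x_0 * (w / x_j)] in [I] for some [j > 0], and a
    minimal generator [w'] divides it.  The exponent of [x_0] in [w'] has to be
    exactly one more than in [w], since otherwise [w'] would properly divide
    [w]; so, away from [x_0], [w'] divides [w / x_j] ([exchange_step]).

    Everything follows from that step.  A minimal generator whose part away from
    [x_0] has least degree admits no further step, hence attains the maximal
    exponent of [x_0] ([max_degree_exists]).  The inclusion of the slice of
    degree [i - 1] in the maximal ideal times the slice of degree [i] is the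
    step itself, the extra factor being [x_j] ([slice_shedding]).  Finally each
    slice is weakly polymatroidal ([slice_weakly_polymatroidal]): an exchange
    between two generators of the same degree in [x_0] stays in [I], and if the
    generator found has too small a degree in [x_0], repeated steps raise it to
    the right slice ([exchange_climb]).  Induction on the number of variables
    concludes. *)

Set Implicit Arguments.
Unset Strict Implicit.
Unset Printing Implicit Defensive.

Import GRing.Theory.
Local Open Scope ring_scope.

Section MonomialIdealFacts.
Variables (K : fieldType) (n : nat).
Implicit Type I : {mpoly K[n]} -> Prop.

Lemma monomial_ideal_ideal I : monomial_ideal I -> is_ideal I.
Proof.
move=> [M IM]; have [g0 gD gM] := ideal_gen_ideal
  (fun p : {mpoly K[n]} => exists2 m, M m & p = 'X_[m]).
split=> [|p q /IM Ip /IM Iq|p q /IM Iq]; apply/IM => //.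
- exact: gD.
- exact: gM.
Qed.

Lemma mon_ideal_le (M : 'X_{1..n} -> Prop) m m' :
  M m -> (m <= m')%MM -> @mon_ideal K n M 'X_[m'].
Proof.
move=> Mm le_mm' J HJ MJ; rewrite -(submK le_mm') mpolyXD.
by case: (HJ) => _ _; apply; apply: MJ; exists m.
Qed.

Lemma mingens_empty I : monomial_ideal I ->
  (forall u, ~ mingens I u) -> ideal_eq I (@ideal0 _).
Proof.
move=> monI noG p; split=> [/(mingens_gen monI) Ip|Ip].
  by apply: Ip; [exact: ideal_gen_ideal | by move=> a [u Gu]; case: (noG u)].
have idI := monomial_ideal_ideal monI.
by apply: Ip => // _ ->; case: idI.
Qed.

Lemma ideal1_intro I : is_ideal I -> I 1 -> ideal_eq I (@ideal1 _).
Proof.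
move=> idI I1 p; split=> [_|Ip]; last by apply: Ip => // _ ->.
move=> J idJ J1; case: idJ => _ _ JM.
by rewrite -[p]mulr1; apply/JM/J1.
Qed.

End MonomialIdealFacts.

Section FirstVariable.
Variables (K : fieldType) (n : nat) (I : {mpoly K[n.+1]} -> Prop).
Hypothesis wpmI : weakly_polymatroidal I.

Local Notation drop0 := (mnm_drop (ord0 : 'I_n.+1)).

Lemma mnm_le_drop (u w : 'X_{1..n.+1}) :
  (u ord0 <= w ord0)%N -> (drop0 u <= drop0 w)%MM -> (u <= w)%MM.
Proof.
move=> le0 /mnm_lepP le_d; apply/mnm_lepP => i.
by case: (unliftP ord0 i) => [k|] -> //; move: (le_d k); rewrite !mnmE.
Qed.

Lemma exchange_step u w : mingens I u -> mingens I w ->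
  (w ord0 < u ord0)%N ->
  exists w' (j : 'I_n), [/\ mingens I w', w' ord0 = (w ord0).+1
    & (U_(j) + drop0 w' <= drop0 w)%MM].
Proof.
move=> Gu Gw lt_wu.
have [||j [lt0j wj]] := wpmI Gu Gw _ lt_wu; [by exists ord0 | by [] |].
case: (unliftP ord0 j) lt0j wj => [k ->|->] // _ wk.
rewrite -mpolyXD => /mingens_below [w' Gw' /mnm_lepP le_w'].
have le_k i : (U_(k)%MM i + w' (lift ord0 i) <= w (lift ord0 i))%N.
  move: (le_w' (lift ord0 i)); rewrite !mnmE (inj_eq lift_inj) /=.
  by case: eqP wk => [<-|_]; lia.
have le_d : (U_(k) + drop0 w' <= drop0 w)%MM.
  by apply/mnm_lepP => i; move: (le_k i); rewrite mnmDE [drop0 w' i]mnmE [drop0 w i]mnmE.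
exists w', k; split=> //.
have := le_w' ord0; rewrite !mnmE /= => le0.
apply/eqP; rewrite eqn_leq; apply/andP; split; first by lia.
(* Otherwise [w'] divides [w], hence equals it, against the factor [x_k]. *)
rewrite ltnNge; apply/negP => le0'.
have e : w' = w.
  apply: (proj2 Gw); first by case: Gw'.
  by apply: mnm_le_drop => //; apply: lepm_trans le_d; exact: lem_addl.
by have := le_k k; rewrite e mnm1E eqxx; lia.
Qed.

Lemma exchange_climb u w i : mingens I u -> mingens I w ->
  (w ord0 <= i <= u ord0)%N ->
  exists w', [/\ mingens I w', w' ord0 = i & (drop0 w' <= drop0 w)%MM].
Proof.
move=> Gu Gw /andP[le_wi]; elim: i le_wi => [|i IH] le_wi le_iu.
  by exists w; split=> //; [lia | exact: lepm_refl].
have [e|lt_wi] := eqVneq (w ord0) i.+1.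
  by exists w; split=> //; exact: lepm_refl.
have [||w1 [Gw1 w1i le1]] := IH; try lia.
have [|w' [j [Gw' w'i le']]] := exchange_step Gu Gw1; first by lia.
exists w'; split=> //; first by lia.
by apply: lepm_trans le1; apply: lepm_trans le'; exact: lem_addl.
Qed.

(** The degree away from [x_0] strictly decreases along [exchange_step], so
    chains of steps are finite; the last generator of a chain has maximal
    exponent of [x_0]. *)
Lemma max_degree_exists w : mingens I w ->
  exists r, is_max_degree ord0 I r.
Proof.
have [k] := ubnP (mdeg (drop0 w)); elim: k w => // k IH w lt_k Gw.
have [[u [Gu lt_wu]]|noup] := classic (exists u, mingens I u /\ (w ord0 < u ord0)%N).
  have [w' [j [Gw' _ le']]] := exchange_step Gu Gw lt_wu.
  apply: (IH w') => //; move: lt_k; rewrite -(submK le') !mdegD mdeg1; lia.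
exists (w ord0); split; first by exists w.
by move=> u Gu; rewrite leqNgt; apply/negP => lt_wu; apply: noup; exists u.
Qed.

Lemma slice_shedding u i : mingens I u -> (i < u ord0)%N ->
  ideal_sub (ext_ideal ord0 (slice ord0 I i))
    (ideal_mul (ext_ideal ord0 (slice ord0 I i.+1)) (@max_ideal K n.+1)).
Proof.
move=> Gu lt_iu p; set J := ideal_mul _ _.
have idJ : is_ideal J by exact: ideal_gen_ideal.
have [J0 JD JM] := idJ.
apply=> // _ [q Sq ->].
(* The polynomials whose extension lies in [J] form an ideal, so it suffices
   to treat the monomials that generate the slice. *)
apply: (Sq (fun q => J (q \mPo [tuple 'X_(lift ord0 i) | i < n]))).
  split=> [|q1 q2 J1 J2|q1 q2 J2]; first by rewrite comp_mpoly0.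
    by rewrite comp_mpolyD; exact: JD.
  by rewrite rmorphM; exact: JM.
move=> _ [_ [w [Gw wi ->]] ->].
have [|w' [j [Gw' w'i le']]] := exchange_step Gu Gw; first by rewrite wi.
rewrite -(submK le') !mpolyXD !rmorphM; apply: (JM) => L _; apply.
exists ('X_[drop0 w'] \mPo [tuple 'X_(lift ord0 i) | i < n]), 'X_(lift ord0 j).
split.
- move=> L' _; apply; exists 'X_[drop0 w'] => //.
  by move=> L'' _; apply; exists (drop0 w') => //; exists w'; rewrite w'i wi.
- by move=> L' _; apply; exists (lift ord0 j).
- by rewrite /= comp_mpolyXU -tnth_nth tnth_mktuple mulrC.
Qed.

Lemma slice_weakly_polymatroidal i :
  weakly_polymatroidal (slice ord0 I i).
Proof.
move=> u' v' Gu' Gv' [s [eq_s lt_s]] t lt_t le_t.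
have mgen := @mingens_min K n (slice ord0 I i) _ (fun p => conj id id).
have [u [Gu ui eu]] := mgen _ Gu'; have [v [Gv vi ev]] := mgen _ Gv'.
have ul k : u (lift ord0 k) = u' k by rewrite eu mnmE.
have vl k : v (lift ord0 k) = v' k by rewrite ev mnmE.
have [|||j [lt_tj vj]] := wpmI Gu Gv _ (t := lift ord0 t).
- exists (lift ord0 s); rewrite ul vl; split=> // k.
  case: (unliftP ord0 k) => [k'|] -> => [lt_ks|_]; last by rewrite ui vi.
  by rewrite ul vl eq_s.
- by rewrite ul vl.
- move=> k; case: (unliftP ord0 k) => [k'|] -> => [lt_kt|_].
    by rewrite ul vl le_t.
  by rewrite ui vi.
case: (unliftP ord0 j) lt_tj vj => [k ->|->] // lt_tk; rewrite vl => vk.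
rewrite -mpolyXD => /mingens_below [w Gw /mnm_lepP le_w].
have [|w' [Gw' w'i le']] := @exchange_climb u w i Gu Gw.
  by have := le_w ord0; rewrite ui leqnn andbT !mnmE /= vi; lia.
exists k; split=> //; rewrite -mpolyXD.
apply: (@mon_ideal_le _ _ _ (drop0 w')); first by exists w'.
apply: lepm_trans le' _; apply/mnm_lepP => l; move: (le_w (lift ord0 l)).
by rewrite !mnmE !(inj_eq lift_inj) vl.
Qed.

End FirstVariable.

Theorem proposition4p33 (K : fieldType) (n : nat) (I : {mpoly K[n]} -> Prop)
  (monI : monomial_ideal I) (wpmI : weakly_polymatroidal I) :
  variable_decomposable I.
Proof.
elim: n I monI wpmI => [|n IH] I monI wpmI /=.
  have [[u [Iu _]]|noG] := classic (exists u, mingens I u).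
    right; apply: ideal1_intro; first exact: monomial_ideal_ideal.
    by rewrite -mpolyX0 (_ : 0%MM = u) //; apply/mnmP => -[].
  by left; apply: mingens_empty => // u Gu; apply: noG; exists u.
have [[w Gw]|noG] := classic (exists u, mingens I u); last first.
  by apply: Or31; apply: mingens_empty => // u Gu; apply: noG; exists u.
have [r maxr] := max_degree_exists wpmI Gw; have [[u Gu ur] _] := maxr.
apply: Or33; exists ord0, r; split=> // [i _|[|i] //= le_ir].
  apply: IH; last exact: slice_weakly_polymatroidal.
  by eexists => p; split; exact.
by apply: (slice_shedding wpmI Gu); rewrite ur.
Qed.
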